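(* Let $G$ be a finite group with identity $e$, and let $X\in M_{|G|}(\mathcal A)$ be self-adjoint, free from $M_{|G|}(\mathbb C)$ with respect to $\varphi$, and with distribution $\mu$. Let $X^t=\sum_{g\in G}Y_g$ be the left $G$-circulant decomposition of $X^t$. Then the distribution of $Y_e$ is $$\mu_{Y_e}=\big(D_{\frac1{|G|}}\mu\big)^{\boxplus |G|}.$$
   Context: $(\mathcal A,\tau)$ is a $*$-probability space (unital complex $*$-algebra with a linear functional $\tau$, $\tau(1)=1$) with $\tau$ tracial. $M_{|G|}(\mathcal A)$ carries $\varphi(A)=\frac1{|G|}\sum_{h\in G}\tau(A_{h,h})$ and contains $M_{|G|}(\mathbb C)$ via $\mathbb C\cdot1\subset\mathcal A$; rows and columns are indexed by $G$ through a fixed enumeration. ''$X$ is free from $M_{|G|}(\mathbb C)$'' means that the unital algebra generated by $X$ and $M_{|G|}(\mathbb C)$ are freely independent with respect to $\varphi$. Transpose: $(X^t)_{p,q}=X_{q,p}$. Left $G$-circulant decomposition of $A\in M_{|G|}(\mathcal A)$: $A=\sum_{g\in G}A_g$ with $(A_g)_{p,q}=A_{p,q}$ if $q=gp$ and $0$ otherwise. The distribution of an element $a$ is determined by its moments $\varphi(a^n)$, $n\ge1$ (equivalently by its free cumulants $\kappa_n(a):=\kappa_n(a,\dots,a)$); it is identified with a probability measure having these moments when appropriate. $D_c\mu$ denotes the dilation of $\mu$ by $c$ (the distribution of $ca$ if $a$ has distribution $\mu$), with $\kappa_n(D_c\mu)=c^n\kappa_n(\mu)$; $\boxplus$ is free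 additive convolution, $\kappa_n(\mu\boxplus\nu)=\kappa_n(\mu)+\kappa_n(\nu)$; and $\mu^{\boxplus t}$ is the free convolution power, $\kappa_n(\mu^{\boxplus t})=t\,\kappa_n(\mu)$. *)

(* Defs.v *)
From mathcomp Require Import all_boot all_order all_algebra all_fingroup.
From mathcomp Require Import reals complex.

Set Implicit Arguments.
Unset Strict Implicit.
Unset Printing Implicit Defensive.

Import Order.TTheory GRing.Theory Num.Theory.
Local Open Scope ring_scope.

(* [mu n] is the n-th moment; [mu 0] is 1 for the distribution of an element. *)
Definition distribution (R : realType) := nat -> R[i].

Definition distr (R : realType) (B : pzRingType) (phi : B -> R[i]) (a : B) :
  distribution R := fun n => phi (a ^+ n).

Definition dilation (R : realType) (c : R[i]) (mu : distribution R) :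
  distribution R := fun n => c ^+ n * mu n.

Definition noncrossing (n : nat) (P : {set {set 'I_n}}) : bool :=
  [forall V in P, forall W in P, (V != W) ==>
    ~~ [exists i in V, exists j in W, exists k in V, exists l in W,
          [&& i < j, j < k & k < l]%N]].

Definition NC (n : nat) : {set {set {set 'I_n}}} :=
  [set P | partition P [set: 'I_n] && noncrossing P].

Definition moments_of_cumulants (R : realType) (kappa : nat -> R[i]) :
  distribution R :=
  fun n => \sum_(P in NC n) \prod_(V in P) kappa #|V|.

(* Solves the moment-cumulant formula for the term of the one-block partition.
   The other terms only involve blocks of size < n, so fuel n is enough. *)
Fixpoint free_cumulant_rec (R : realType) (mu : distribution R)
    (fuel n : nat) : R[i] :=
  if fuel is fuel'.+1 then
    mu n - \sum_(P in NC n | P != [set [set: 'I_n]])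
             \prod_(V in P) free_cumulant_rec mu fuel' #|V|
  else 0.

Definition free_cumulant (R : realType) (mu : distribution R) (n : nat) : R[i] :=
  free_cumulant_rec mu n n.

Definition free_power (R : realType) (mu : distribution R) (t : R[i]) :
  distribution R :=
  moments_of_cumulants (fun n => t * free_cumulant mu n).

Section CumulantFacts.
Variable R : realType.
Implicit Types (mu : distribution R) (kappa : nat -> R[i]).

Lemma one_block_NC n : (0 < n)%N -> [set [set: 'I_n]] \in NC n.
Proof.
move=> n_gt0; rewrite inE; apply/andP; split.
  apply/and3P; split.
  - by rewrite /cover big_set1.
  - apply/trivIsetP => V W; rewrite !inE => /eqP -> /eqP ->.
    by rewrite eqxx.
  - rewrite inE eq_sym; apply/set0Pn; exists (Ordinal n_gt0).
    by rewrite inE.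
apply/forall_inP => V; rewrite inE => /eqP ->.
apply/forall_inP => W; rewrite inE => /eqP ->.
by rewrite eqxx.
Qed.

Lemma NC_block_lt n (P : {set {set 'I_n}}) V :
  P \in NC n -> P != [set [set: 'I_n]] -> V \in P -> (0 < #|V| < n)%N.
Proof.
rewrite inE => /andP [partP _] P1 VP.
have [/eqP covP tP P0] := and3P partP.
have V0 : V != set0 by apply: contraNneq P0 => <-.
rewrite card_gt0 V0 /=.
rewrite ltn_neqAle -[X in (_ <= X)%N](card_ord n) max_card andbT.
apply: contra P1 => /eqP cV.
have VT : V = [set: 'I_n].
  by apply/eqP; rewrite eqEcard subsetT cardsT card_ord cV /=.
rewrite eqEsubset; apply/andP; split; last by rewrite sub1set -VT.
apply/subsetP => W WP; rewrite inE -VT.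
apply/negPn/negP => WV.
have /trivIsetP/(_ _ _ WP VP WV) := tP.
rewrite VT -setI_eq0 setIT => /eqP W0.
by rewrite -W0 WP in P0.
Qed.

Lemma free_cumulant_recE mu d n :
  (n <= d)%N -> (0 < n)%N -> free_cumulant_rec mu d n = free_cumulant mu n.
Proof.
rewrite /free_cumulant => led n_gt0.
elim/ltn_ind: n d led n_gt0 => n IH [|d] /=; first by case: n {IH}.
case: n IH => // n IH led _ /=; congr (_ - _).
apply: eq_bigr => P /andP [PNC P1]; apply: eq_bigr => V VP.
have /andP [V0 Vn] := NC_block_lt PNC P1 VP.
rewrite (IH _ Vn d) // ?(IH _ Vn n) //.
by rewrite -ltnS (leq_trans Vn).
Qed.

Lemma moments_of_cumulantsK mu n : (0 < n)%N ->
  moments_of_cumulants (free_cumulant mu) n = mu n.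
Proof.
move=> n_gt0; rewrite /moments_of_cumulants.
rewrite (bigD1 [set [set: 'I_n]]) ?one_block_NC //= big_set1 cardsT card_ord.
rewrite {1}/free_cumulant.
case: n n_gt0 => // n _; rewrite /= -addrA -[RHS]addr0; congr (_ + _).
apply/eqP; rewrite addrC subr_eq0; apply/eqP.
apply: eq_bigr => P /andP [PNC P1]; apply: eq_bigr => V VP.
have /andP [V0 Vn] := NC_block_lt PNC P1 VP.
by rewrite free_cumulant_recE.
Qed.

Lemma free_cumulantK kappa n : (0 < n)%N ->
  free_cumulant (moments_of_cumulants kappa) n = kappa n.
Proof.
elim/ltn_ind: n => -[|n] // IH _.
rewrite /free_cumulant /= {1}/moments_of_cumulants.
rewrite (bigD1 [set [set: 'I_n.+1]]) ?one_block_NC //= big_set1 cardsT card_ord.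
rewrite -addrA -[RHS]addr0; congr (_ + _).
apply/eqP; rewrite subr_eq0; apply/eqP.
apply: eq_bigr => P /andP [PNC P1]; apply: eq_bigr => V VP.
have /andP [V0 Vn] := NC_block_lt PNC P1 VP.
by rewrite free_cumulant_recE // IH.
Qed.

Lemma free_cumulant_power mu t n : (0 < n)%N ->
  free_cumulant (free_power mu t) n = t * free_cumulant mu n.
Proof. exact: free_cumulantK. Qed.

End CumulantFacts.

Definition freely_independent (K : pzRingType) (B : pzRingType) (phi : B -> K)
    (I : eqType) (S : I -> B -> Prop) : Prop :=
  forall s : seq (I * B),
    s != [::] ->
    sorted (fun u v => u.1 != v.1) s ->
    (forall u, u \in s -> S u.1 u.2 /\ phi u.2 = 0) ->
    phi (\prod_(u <- s) u.2) = 0.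

Record is_star (R : realType) (A : algType R[i]) (star : A -> A) : Prop :=
  IsStar {
    star_involutive : involutive star;
    star_add : {morph star : a b / a + b};
    star_conj_scale : forall (c : R[i]) (a : A), star (c *: a) = Num.conj c *: star a;
    star_antimul : forall a b : A, star (a * b) = star b * star a
  }.

(* Positivity of [tau] is not required. *)
Record is_tracial_star_probability_space (R : realType) (A : algType R[i])
    (star : A -> A) (tau : {scalar A}) : Prop := IsTracialStarProbabilitySpace {
  space_star : is_star star;
  space_unit : tau 1 = 1;
  space_tracial : forall a b : A, tau (a * b) = tau (b * a)
}.

Section Matrices.
Variables (R : realType) (A : algType R[i]).

Definition mx_state (tau : A -> R[i]) (n : nat) (M : 'M[A]_n) : R[i] :=
  n%:R^-1 * \sum_h tau (M h h).

Definition mx_adjoint (star : A -> A) (n : nat) (M : 'M[A]_n) : 'M[A]_n :=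
  map_mx star M^T.

(* The complex unital algebra generated by X, complex scalars acting on
   matrices through the scalars of [A]. *)
Inductive generated_algebra (n : nat) (X : 'M[A]_n) : 'M[A]_n -> Prop :=
| generated_self : generated_algebra X X
| generated_scalar (c : R[i]) : generated_algebra X (c%:A)%:M
| generated_add (M N : 'M[A]_n) :
    generated_algebra X M -> generated_algebra X N -> generated_algebra X (M + N)
| generated_mul (M N : 'M[A]_n) :
    generated_algebra X M -> generated_algebra X N -> generated_algebra X (M *m N).

Definition complex_matrix (n : nat) (M : 'M[A]_n) : Prop :=
  exists N : 'M[R[i]]_n, M = map_mx (in_alg A) N.

Definition free_from_complex_matrices (tau : A -> R[i]) (n : nat)
    (X : 'M[A]_n) : Prop :=
  freely_independent (@mx_state tau n)
    (fun b : bool => if b then generated_algebra X else @complex_matrix n).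

(* [en] is the enumeration of the group indexing rows and columns. *)
Definition left_circulant (gT : finGroupType) (en : 'I_#|gT| -> gT)
    (M : 'M[A]_#|gT|) (g : gT) : 'M[A]_#|gT| :=
  \matrix_(i, j) if en j == (g * en i)%g then M i j else 0.

Lemma left_circulant_sum (gT : finGroupType) (en : 'I_#|gT| -> gT)
    (M : 'M[A]_#|gT|) : M = \sum_g left_circulant en M g.
Proof.
apply/matrixP => i j; rewrite summxE (bigD1 (en j * (en i)^-1)%g) //=.
rewrite mxE mulgKV eqxx big1 ?addr0 // => g gN; rewrite mxE ifN //.
by apply: contraNneq gN => ->; rewrite mulgK.
Qed.

End Matrices.

(* Main.v *)
From HB Require Import structures.
Require Import Defs.
From mathcomp Require Import all_boot all_order all_algebra all_fingroup.
From mathcomp Require Import reals complex zify.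

Set Implicit Arguments.
Unset Strict Implicit.
Unset Printing Implicit Defensive.

Import Order.TTheory GRing.Theory Num.Theory.
Local Open Scope ring_scope.

(** Write N for the order of the group and alpha = 1/N. A left translation by
    the identity fixes every index, so Y_e is the diagonal part of X^t, which
    is the diagonal part of X, and the j-th moment of Y_e is the average over i
    of tau (X_ii ^ j). With p = E_ii, a projection with phi p = alpha which is
    free from X, tau (X_ii ^ j) is alpha^-1 phi ((p X)^j p): the moment of the
    free compression of X by p. So the claim, for each single i, is the theorem
    of Nica and Speicher that the cumulants of that compression are
    alpha^(s-1) kappa_s(X) = N * kappa_s (X / N).

    Cumulants are handled through formal series. Splitting a noncrossing
    partition at the second element of its first block ([NC_sum_rec]) yields
    the equation F = sum_s kappa_s (w F)^s for the moment series F
    ([moment_series]).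

    Freeness is used through a resolvent. Let M be the moment series of X and
    R = (1 - w X)^-1, so that a = R - M and b = p - alpha have centred
    coefficients. In the expansion of p (alpha M - a b)^-1 R all terms are
    alternating words in a and b, and only the empty word survives phi; hence
    phi (p (alpha M - a b)^-1 R) = 1 ([compression_moment_relation]). On the
    other hand (1 - w X)(alpha M - a b) = (alpha - p) + (1 - w X) M p, and
    p times the inverse of this element is the geometric series
    sum_j y^j u^(-j-1) (p X)^j p with y = w M and u = alpha - 1 + M. So
    the moments t_j = phi ((p X)^j p) satisfy sum_j t_j (y/u)^j = u.

    As y/u has order exactly one, this equation determines the t_j
    ([subordination_relation_unique]). The moments H_j with cumulants
    alpha^(s-1) kappa_s, times alpha, satisfy it too
    ([compression_series_relation]): both u / alpha and the series H at y/u
    solve f = sum_s kappa'_s ((y/u) f)^s, which has one solution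
    ([fixpoint_unique]).

    Series are polynomials compared up to a given order, and the inverses of
    alpha M - a b and of u are cleared by multiplying with a power of alpha M
    or of u. *)

(** * Noncrossing partitions of an interval *)

Definition ord_interval N (a b : nat) : {set 'I_N} := [set i : 'I_N | (a <= i < b)%N].

Definition NC_interval N a b : {set {set {set 'I_N}}} :=
  [set P | partition P (ord_interval N a b) && noncrossing P].

Lemma NC_intervalP N a b (P : {set {set 'I_N}}) : reflect
  [/\ forall V i, V \in P -> i \in V -> (a <= i < b)%N,
      forall i : 'I_N, (a <= i < b)%N -> exists2 V, V \in P & i \in V,
      forall V W i, V \in P -> W \in P -> i \in V -> i \in W -> V = W,
      forall V, V \in P -> exists i, i \in V
    & forall V W (i j k l : 'I_N), V \in P -> W \in P ->
        i \in V -> j \in W -> k \in V -> l \in W -> (i < j)%N -> (j < k)%N -> (k < l)%N -> V = W]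
  (P \in NC_interval N a b).
Proof.
rewrite inE; apply: (iffP andP).
  case=> /and3P[/eqP cP /trivIsetP tP P0] ncP; split.
  - move=> V i VP iV; have: i \in ord_interval N a b by rewrite -cP; apply/bigcupP; exists V.
    by rewrite inE.
  - move=> i iab; have : i \in cover P by rewrite cP inE.
    by case/bigcupP=> V VP iV; exists V.
  - move=> V W i VP WP iV iW; apply/eqP; apply: contraT => VW.
    have := tP _ _ VP WP VW; rewrite -setI_eq0 => /eqP VW0.
    by have := in_set0 i; rewrite -VW0 inE iV iW.
  - by move=> V VP; apply/set0Pn; apply: contraNneq P0 => <-.
  - move=> V W i j k l VP WP iV jW kV lW ij jk kl.
    apply/eqP; apply: contraT => VW.
    move/forall_inP/(_ _ VP)/forall_inP/(_ _ WP)/implyP/(_ VW)/negP: ncP; case.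
    apply/exists_inP; exists i => //; apply/exists_inP; exists j => //.
    apply/exists_inP; exists k => //; apply/exists_inP; exists l => //.
    by rewrite ij jk kl.
case=> inS cov dis ne nc; split; last first.
  apply/forall_inP => V VP; apply/forall_inP => W WP; apply/implyP => VW.
  apply/negP => /exists_inP[i iV /exists_inP[j jW /exists_inP[k kV /exists_inP[l lW]]]].
  case/and3P=> ij jk kl; case/eqP: VW; exact: (nc V W i j k l).
apply/and3P; split.
- apply/eqP/setP => i; rewrite inE; apply/bigcupP/idP.
    by case=> V VP iV; apply: (inS V).
  by move=> /cov[V VP iV]; exists V.
- apply/trivIsetP => V W VP WP VW; rewrite -setI_eq0; apply/negPn/negP; case/set0Pn => i.
  by rewrite inE => /andP[iV iW]; rewrite (dis V W i) ?eqxx in VW.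
- by apply/negP => /ne []i; rewrite inE.
Qed.

(** A union rather than a choice of block, with [c] a natural number: at the
    right end of an interval no element has value [c] and this gives the empty
    set, so the case where the first block is a singleton needs no separate
    treatment in the recursion below. *)
Definition block_at N (c : nat) (P : {set {set 'I_N}}) : {set 'I_N} :=
  \bigcup_(V in P | [exists i in V, i == c :> nat]) V.

Lemma block_at_mem N a b P V (i : 'I_N) :
  P \in NC_interval N a b -> V \in P -> i \in V -> block_at i P = V.
Proof.
case/NC_intervalP => _ _ dis _ _ VP iV; rewrite /block_at (bigD1 V) /=; last first.
  by rewrite VP; apply/exists_inP; exists i.
rewrite big_pred0 ?setU0 // => W; apply/negbTE/negP => /andP[/andP[WP /exists_inP[j jW]]].
by move=> /eqP /val_inj ji; subst j; rewrite (dis W V i) ?eqxx.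
Qed.

Lemma block_at_empty N (P : {set {set 'I_N}}) c :
  P \in NC_interval N c c -> block_at c P = set0.
Proof.
case/NC_intervalP => inS _ _ ne _; rewrite /block_at big_pred0 // => V.
apply/negbTE/negP => /andP[VP _]; have [i iV] := ne V VP.
have := inS V i VP iV; lia.
Qed.

Lemma block_at_sub N P a b c (i : 'I_N) : P \in NC_interval N a b -> i \in block_at c P -> (a <= i < b)%N.
Proof. by case/NC_intervalP => inS _ _ _ _ /bigcupP[V /andP[VP _] iV]; apply: (inS V). Qed.

Lemma block_at_first N P c b : (c <= b <= N)%N -> P \in NC_interval N c b ->
  (c = b /\ block_at c P = set0) \/ ((c < b)%N /\ block_at c P \in P /\ exists2 i : 'I_N, i = c :> nat & i \in block_at c P).
Proof.
move=> /andP[cb bN] PNC; case: (ltngtP c b) cb => // [cb _|eb _].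
  right; split=> //; have cN : (c < N)%N by lia.
  have /NC_intervalP[_ cov _ _ _] := PNC.
  have [|V VP iV] := cov (Ordinal cN); first by rewrite /= leqnn.
  have -> : block_at c P = V by rewrite -(block_at_mem PNC VP iV).
  by split=> //; exists (Ordinal cN).
by left; subst c; split=> //; apply: block_at_empty.
Qed.

(** * Splitting off the first element *)

(** Let [x] be the first element, of value [a], of the interval from [a] to [b],
    and [c] the next element of its block, or [b] if there is none. Since the
    partition is noncrossing, no other block meets both sides of [c], so it
    amounts to a partition of the gap between [x] and [c] together with one of
    the interval from [c] to [b], where [x] is attached to the block of [c]. *)

Section Bijection.
Variables (N a b c : nat) (x : 'I_N).
Hypotheses (xa : x = a :> nat) (ac : (a < c)%N) (cb : (c <= b)%N) (bN : (b <= N)%N).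

Definition glue (u : {set {set 'I_N}} * {set {set 'I_N}}) :=
  (x |: block_at c u.2) |: (u.1 :|: (u.2 :\ block_at c u.2)).

Definition cut (P : {set {set 'I_N}}) :=
  ([set V in P | V \subset ord_interval N a.+1 c],
   [set V :\ x | V in [set V in P | ~~ (V \subset ord_interval N a.+1 c)]] :\ set0).

(** The value [c = b] encodes that [x] is alone in its block. *)
Definition next_in_block (P : {set {set 'I_N}}) :=
  [forall i in block_at a P, (i == x) || (c <= i)%N] &&
  ((c == b) || [exists i in block_at a P, i == c :> nat]).

Lemma glue_NC P1 P2 : P1 \in NC_interval N a.+1 c -> P2 \in NC_interval N c b ->
  glue (P1, P2) \in NC_interval N a b.
Proof.
move=> P1NC P2NC; rewrite /glue /=; set B := block_at c P2.
have inB i : i \in B -> (c <= i < b)%N by apply: block_at_sub.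
have BC : (c = b /\ B = set0) \/ ((c < b)%N /\ B \in P2 /\ exists2 i : 'I_N, i = c :> nat & i \in B).
  by apply: block_at_first => //; rewrite cb.
case/NC_intervalP: P1NC => in1 cov1 dis1 ne1 nc1.
case/NC_intervalP: P2NC => in2 cov2 dis2 ne2 nc2.
have inx i : i \in x |: B -> i = x \/ i \in B /\ (c <= i < b)%N.
  by rewrite !inE => /orP[/eqP|iB]; [left | right; split=> //; apply: inB].
have disB W i : W \in P2 -> W != B -> i \in W -> i \in B -> False.
  case: BC => [[_ ->]|[_ [BP _]]]; first by rewrite inE.
  by move=> WP WB iW iB; case/eqP: WB; apply: dis2 iW iB.
apply/NC_intervalP; split.
- move=> V i; rewrite !inE => /or3P[/eqP->|VP|/andP[_ VP]].
  + by case/inx=> [->|[_]]; lia.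
  + by move/(in1 _ _ VP); lia.
  + by move/(in2 _ _ VP); lia.
- move=> i iab; case: (ltngtP i a) => [|ai|ia]; first by lia.
  + case: (ltnP i c) => ic.
      have [|V VP iV] := cov1 i; first by lia.
      by exists V => //; rewrite !inE VP orbT.
    have [|V VP iV] := cov2 i; first by lia.
    case: (eqVneq V B) => [VB|VB].
      by exists (x |: B); rewrite !inE ?eqxx // -VB iV orbT.
    by exists V => //; rewrite !inE VP VB !orbT.
  + by exists (x |: B); rewrite !inE ?eqxx // -val_eqE /= ia xa eqxx.
- move=> V W i; rewrite !inE => /or3P[/eqP->|VP|/andP[VB VP]] /or3P[/eqP->|WP|/andP[WB WP]] //.
  + by case/inx=> [->|[_ h]] /(in1 _ _ WP); lia.
  + case/inx=> [->|[h _]]; first by move/(in2 _ _ WP); lia.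
    by move=> /(disB _ _ WP WB) /(_ h).
  + by move=> /(in1 _ _ VP) h /inx[ix|[_]]; [subst i | ]; lia.
  + exact: dis1.
  + by move=> /(in1 _ _ VP) h /(in2 _ _ WP); lia.
  + move=> h /inx[ix|[iB _]]; first by subst i; have := in2 _ _ VP h; lia.
    by have := disB _ _ VP VB h iB.
  + by move=> /(in2 _ _ VP) h /(in1 _ _ WP); lia.
  + exact: dis2.
- move=> V; rewrite !inE => /or3P[/eqP->|VP|/andP[VB VP]].
  + by exists x; rewrite !inE eqxx.
  + exact: ne1.
  + exact: ne2.
- move=> V W i j k l; rewrite !inE => /or3P[/eqP->|VP|/andP[VB VP]] /or3P[/eqP->|WP|/andP[WB WP]] //.
  + move=> _ /(in1 _ _ WP) jr /inx[->|[_ kr]] /(in1 _ _ WP); lia.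
  + move=> /inx[ix|[iB ir]] jW /inx[kx|[kB kr]] lW ij jk kl; last 1 first.
    * case: BC iB => [[_ ->]|[_ [BP _]]]; first by rewrite inE.
      by move=> iB; have := nc2 _ _ _ _ _ _ BP WP iB jW kB lW ij jk kl => e; rewrite e eqxx in WB.
    * by subst k i; lia.
    (* [i] is [x], which lies in no block of [P2]; the element [c] of [B] replaces it *)
    * subst i; case: BC kB => [[_ ->]|[_ [BP [i ic iB]]]]; first by rewrite inE.
      move=> kB; have ij' : (i < j)%N.
        have jc := in2 _ _ WP jW; rewrite ltn_neqAle ic.
        case/andP: jc => -> _; rewrite andbT -ic; apply/eqP => /val_inj e; subst j.
        by have := disB _ _ WP WB jW iB.
      by have := nc2 _ _ _ _ _ _ BP WP iB jW kB lW ij' jk kl => e; rewrite e eqxx in WB.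
    * by subst k; lia.
  + by move=> /(in1 _ _ VP) ir /inx[->|[_ jr]] /(in1 _ _ VP) kr _; lia.
  + exact: nc1.
  + by move=> /(in1 _ _ VP) ir /(in2 _ _ WP) jr /(in1 _ _ VP) kr _; lia.
  + move=> iV /inx[->|[jB jr]] kV /inx[->|[lB lr]] ij jk kl.
    * by lia.
    * by have := in2 _ _ VP iV; lia.
    * by lia.
    * case: BC jB => [[_ ->]|[_ [BP _]]]; first by rewrite inE.
      by move=> jB; have := nc2 _ _ _ _ _ _ VP BP iV jB kV lB ij jk kl => e; rewrite e eqxx in VB.
  + by move=> /(in2 _ _ VP) ir /(in1 _ _ WP) jr /(in2 _ _ VP) kr /(in1 _ _ WP); lia.
  + exact: nc2.
Qed.

Lemma block_at_glue P1 P2 : P1 \in NC_interval N a.+1 c -> P2 \in NC_interval N c b ->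
  block_at a (glue (P1, P2)) = x |: block_at c P2.
Proof.
move=> h1 h2; rewrite -xa; apply: (block_at_mem (glue_NC h1 h2)).
  by rewrite !inE eqxx.
by rewrite !inE eqxx.
Qed.

Lemma glue_next P1 P2 : P1 \in NC_interval N a.+1 c -> P2 \in NC_interval N c b ->
  next_in_block (glue (P1, P2)).
Proof.
move=> h1 h2; rewrite /next_in_block block_at_glue //; apply/andP; split.
  apply/forall_inP => i; rewrite !inE => /orP[->//|/(block_at_sub h2)].
  by case/andP=> ->; rewrite orbT.
have [|[e _]|[_ [_ [i ic iB]]]] := @block_at_first N P2 c b _ h2.
- by rewrite cb.
- by rewrite e eqxx.
- by apply/orP; right; apply/exists_inP; exists i; rewrite ?ic // !inE iB orbT.
Qed.

Lemma cut_glue P1 P2 : P1 \in NC_interval N a.+1 c -> P2 \in NC_interval N c b ->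
  cut (glue (P1, P2)) = (P1, P2).
Proof.
move=> P1NC P2NC; rewrite /cut /glue /=; set B := block_at c P2.
have inB i : i \in B -> (c <= i < b)%N by apply: block_at_sub.
have BC : B = set0 \/ B \in P2.
  have [|[_]|[_ [BP _]]] := @block_at_first N P2 c b _ P2NC; first by rewrite cb.
    by left.
  by right.
case/NC_intervalP: P1NC => in1 cov1 dis1 ne1 nc1.
case/NC_intervalP: P2NC => in2 cov2 dis2 ne2 nc2.
have sub1 V : V \in P1 -> V \subset ord_interval N a.+1 c.
  by move=> VP; apply/subsetP => i iV; rewrite inE; apply: in1 iV.
have sub2 V : V \in P2 -> (V \subset ord_interval N a.+1 c) = false.
  move=> VP; apply/negP => /subsetP s; have [i iV] := ne2 V VP.
  by have := s i iV; have := in2 V i VP iV; rewrite inE; lia.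
have subx : (x |: B \subset ord_interval N a.+1 c) = false.
  by apply/negP => /subsetP/(_ x); rewrite !inE eqxx => /(_ isT); lia.
have xB : x \notin B by apply/negP => /inB; lia.
have xP2 V : V \in P2 -> V :\ x = V.
  by move=> VP; apply/setDidPl; rewrite disjoint_sym disjoints1; apply/negP => /(in2 _ _ VP); lia.
congr pair; apply/setP => V.
  rewrite !inE; case: (boolP (V \in P1)) => VP /=; first by rewrite orbT sub1.
  case: eqP => [->|_] /=; first by rewrite subx.
  by apply/negP => /andP[/andP[_ /sub2->]].
rewrite !inE; apply/andP/idP.
  case=> V0 /imsetP[W]; rewrite !inE => /andP[/or3P[/eqP->|WP|/andP[_ WP]]].
  + by rewrite setU1K // => _ VB; case: BC => [B0|BP]; [rewrite VB B0 eqxx in V0| rewrite VB].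
  + by rewrite sub1.
  + by rewrite xP2 // => _ ->.
move=> VP; split; first by have [i iV] := ne2 V VP; apply/set0Pn; exists i.
apply/imsetP; case: (eqVneq V B) => [->|VB].
  by exists (x |: B); rewrite ?setU1K // !inE eqxx subx.
by exists V; rewrite ?xP2 // !inE VB VP !orbT /= sub2.
Qed.

Section Cut.
Variable P : {set {set 'I_N}}.
Hypotheses (PNC : P \in NC_interval N a b) (nP : next_in_block P).

Let first_block : exists V0, [/\ V0 \in P, x \in V0, block_at a P = V0,
   forall i, i \in V0 -> i != x -> (c <= i < b)%N
  & c = b \/ exists2 i : 'I_N, i = c :> nat & i \in V0].
Proof.
have /NC_intervalP[inP cov _ _ _] := PNC.
have [|V VP xV] := cov x; first by lia.
have bV : block_at a P = V by rewrite -xa; exact: block_at_mem PNC VP xV.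
exists V; split=> //; case/andP: nP; rewrite bV.
  by move=> /forall_inP h _ i iV ix; have := inP _ _ VP iV; have := h i iV; rewrite (negbTE ix) /=; lia.
move=> _ /orP[/eqP|/exists_inP[i iV /eqP ic]]; first by left.
by right; exists i.
Qed.

(** A block going past [c] from the gap below it would cross the pair [x], [c]
    of the first block. *)
Let side_of_next V0 V i j : V0 \in P -> x \in V0 -> (forall i, i \in V0 -> i != x -> (c <= i < b)%N) ->
  (c = b \/ exists2 i : 'I_N, i = c :> nat & i \in V0) -> V \in P -> x \notin V ->
  i \in V -> j \in V -> (i < c)%N -> (j < c)%N.
Proof.
have /NC_intervalP[inP cov dis ne nc] := PNC.
move=> V0P xV0 inV0 cV0 VP xV iV jV ic; rewrite ltnNge; apply/negP => cj.
have VV0 : V <> V0 by move=> e; rewrite e xV0 in xV.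
have xi : (x < i)%N.
  rewrite ltn_neqAle xa; have := inP _ _ VP iV => /andP[-> _]; rewrite andbT -xa.
  by apply/eqP => /val_inj e; rewrite e iV in xV.
case: cV0 => [e|[k kc kV0]]; first by have := inP _ _ VP jV; lia.
have kj : (k < j)%N.
  rewrite ltn_neqAle kc cj andbT -kc; apply/eqP => /val_inj e.
  by apply: VV0; apply: (dis _ _ j) => //; rewrite -e.
by apply: VV0; apply/esym; apply: (nc _ _ x i k j) => //; rewrite kc.
Qed.

Lemma cut_NC : (cut P).1 \in NC_interval N a.+1 c /\ (cut P).2 \in NC_interval N c b.
Proof.
have [V0 [V0P xV0 _ inV0 cV0]] := first_block.
have /NC_intervalP[inP cov dis ne nc] := PNC.
have side := side_of_next V0P xV0 inV0 cV0.
have xNV V i : V \in P -> i \in V -> (i < c)%N -> i != x -> x \notin V.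
  move=> VP iV ic ix; apply/negP => xV.
  have e := dis _ _ _ VP V0P xV xV0; subst V.
  by have := inV0 _ iV ix; lia.
have xV' (V : {set 'I_N}) i : x \notin V -> i \in V -> i != x by move=> h iV; apply: contraNneq h => <-.
have neqx (i : 'I_N) : (i != x) = (i != a :> nat) by rewrite -val_eqE /= xa.
split; apply/NC_intervalP; split; rewrite /=.
- move=> V i; rewrite inE => /andP[VP /subsetP s] /s; by rewrite inE.
- move=> i iac; have [|V VP iV] := cov i; first by lia.
  have xV : x \notin V by apply: (xNV V i) => //; [lia | rewrite neqx; lia].
  exists V => //; rewrite inE VP; apply/subsetP => j jV; rewrite inE.
  have jc : (j < c)%N by apply: (side V i j) => //; lia.
  rewrite jc andbT; have := xV' V j xV jV; rewrite neqx.
  by have := inP _ _ VP jV; lia.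
- move=> V W i; rewrite !inE => /andP[VP _] /andP[WP _]; exact: dis.
- move=> V; rewrite inE => /andP[VP _]; exact: ne.
- move=> V W i j k l; rewrite !inE => /andP[VP _] /andP[WP _]; exact: nc.
- move=> V i; rewrite !inE => /andP[_ /imsetP[W]]; rewrite inE => /andP[WP nW] ->.
  rewrite !inE => /andP[ix iW]; have := inP _ _ WP iW => /andP[ai ->]; rewrite andbT leqNgt.
  apply/negP => ic; case/negP: nW; apply/subsetP => j jW; rewrite inE.
  have xW := xNV _ _ WP iW ic ix.
  rewrite (side W i j) // andbT; have := xV' _ _ xW jW; rewrite neqx.
  by have := inP _ _ WP jW; lia.
- move=> i icb; have [|V VP iV] := cov i; first by lia.
  have iVx : i \in V :\ x by rewrite !inE iV neqx andbT; lia.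
  exists (V :\ x) => //; rewrite !inE; apply/andP; split.
    by apply/set0Pn; exists i.
  apply/imsetP; exists V => //; rewrite inE VP; apply/negP => /subsetP/(_ _ iV).
  by rewrite inE; lia.
- move=> V W i; rewrite !inE => /andP[_ /imsetP[V']] + + /andP[_ /imsetP[W']].
  rewrite !inE => /andP[VP _] -> /andP[WP _] ->.
  by rewrite !inE => /andP[_ iV] /andP[_ iW]; rewrite (dis V' W' i).
- by move=> V; rewrite !inE => /andP[/set0Pn].
- move=> V W i j k l; rewrite !inE => /andP[_ /imsetP[V']] + + /andP[_ /imsetP[W']].
  rewrite !inE => /andP[VP _] -> /andP[WP _] ->.
  rewrite !inE => /andP[_ iV] /andP[_ jW] /andP[_ kV] /andP[_ lW] ij jk kl.
  by rewrite (nc V' W' i j k l).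
Qed.

Lemma glue_cut : glue (cut P) = P.
Proof.
have [V0 [V0P xV0 bV0 inV0 cV0]] := first_block.
have /NC_intervalP[inP cov dis ne nc] := PNC.
have [_ h2] := cut_NC.
have nV0 : ~~ (V0 \subset ord_interval N a.+1 c).
  by apply/negP => /subsetP/(_ x xV0); rewrite inE; lia.
have bc : block_at c (cut P).2 = V0 :\ x.
  have [/= cb0|[i ic iV0]] := cV0.
    rewrite block_at_empty; last by move: h2; rewrite -cb0.
    apply/esym/eqP; rewrite -subset0; apply/subsetP => i; rewrite !inE => /andP[ix iV].
    by have := inV0 _ iV ix; lia.
  have iV0' : i \in V0 :\ x by rewrite !inE iV0 -val_eqE /= andbT; lia.
  rewrite -ic; apply: (block_at_mem h2) => //; rewrite !inE; apply/andP; split.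
    by apply/set0Pn; exists i.
  by apply/imsetP; exists V0; rewrite // inE V0P.
rewrite /glue bc setD1K //; apply/setP => V; rewrite !inE.
apply/or3P/idP.
  case=> [/eqP-> //|/andP[] //|].
  case/and3P=> VV0 _ /imsetP[W]; rewrite inE => /andP[WP nW] e; subst V.
  suff -> : W :\ x = W by [].
  apply/setDidPl; rewrite disjoint_sym disjoints1; apply/negP => xW.
  by rewrite (dis _ _ _ WP V0P xW xV0) eqxx in VV0.
move=> VP; case: (eqVneq V V0) => [->|VV0]; first by apply: Or31.
case: (boolP (V \subset ord_interval N a.+1 c)) => sV.
  by apply: Or32; rewrite VP.
have xV : x \notin V by apply/negP => xV; rewrite (dis _ _ _ VP V0P xV xV0) eqxx in VV0.
have Vx : V = V :\ x by apply/esym/setDidPl; rewrite disjoint_sym disjoints1.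
have [i iV] := ne _ VP.
apply: Or33; apply/and3P; split.
- apply: contraNneq VV0 => e; rewrite e in iV.
  by apply/eqP; apply: (dis _ _ i) => //; [rewrite e | move: iV; rewrite inE => /andP[]].
- by apply/set0Pn; exists i.
- by apply/imsetP; exists V; rewrite // inE VP.
Qed.

End Cut.
End Bijection.

(** * The recursion for noncrossing sums *)

Section Weights.
Variables (K : comPzRingType) (kappa : nat -> K).
Hypothesis kappa0 : kappa 0 = 1.

(** The shift [j] counts the elements already removed from the first block. *)
Definition weight N (j c : nat) (P : {set {set 'I_N}}) : K :=
  kappa (#|block_at c P| + j) * \prod_(V in P | V != block_at c P) kappa #|V|.

Definition NC_sum N (j a b : nat) : K := \sum_(P in NC_interval N a b) weight j a P.

Lemma weight0E N a b P : (a <= b <= N)%N -> P \in NC_interval N a b ->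
  weight 0 a P = \prod_(V in P) kappa #|V|.
Proof.
move=> abN PNC; rewrite /weight addn0.
have [[_ B0]|[_ [BP _]]] := block_at_first abN PNC; last by rewrite [RHS](bigD1 _ BP).
rewrite B0 cards0 kappa0 mul1r; apply: eq_bigl => V; apply: andb_idr => VP.
have /NC_intervalP[_ _ _ ne _] := PNC.
by have [i iV] := ne V VP; apply/set0Pn; exists i.
Qed.

Lemma weight_glue N a b c (x : 'I_N) j P1 P2 : x = a :> nat -> (a < c <= b)%N -> (b <= N)%N ->
  P1 \in NC_interval N a.+1 c -> P2 \in NC_interval N c b ->
  weight j a (glue c x (P1, P2)) = weight 0 a.+1 P1 * weight j.+1 c P2.
Proof.
move=> xa /andP[ac cb] bN h1 h2; rewrite (weight0E _ h1) ?ac ?(leq_trans cb) //.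
rewrite /weight (block_at_glue xa _ _ _ h1 h2) // /glue /=; set B := block_at c P2.
have inB i : i \in B -> (c <= i < b)%N by apply: block_at_sub.
have xB : x \notin B by apply/negP => /inB; lia.
rewrite cardsU1 xB add1n addSnnS mulrCA; congr (_ * _).
have n1 V : V \in P1 -> x \notin V.
  by case/NC_intervalP: h1 => in1 _ _ _ _ VP; apply/negP => /(in1 _ _ VP); lia.
have n2 V : V \in P2 -> x \notin V.
  by case/NC_intervalP: h2 => in2 _ _ _ _ VP; apply/negP => /(in2 _ _ VP); lia.
have nx (V : {set 'I_N}) : x \notin V -> V == x |: B = false.
  by move=> xV; apply/negP => /eqP e; rewrite e !inE eqxx in xV.
have d12 (V : {set 'I_N}) : V \in P1 -> V \notin P2.
  move=> VP1; apply/negP => VP2.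
  case/NC_intervalP: h1 => in1 _ _ ne _; case/NC_intervalP: h2 => in2 _ _ _ _.
  by have [i iV] := ne _ VP1; have := in1 _ _ VP1 iV; have := in2 _ _ VP2 iV; lia.
rewrite (bigID (mem P1)) /=; congr (_ * _); apply: eq_bigl => V; rewrite !inE.
  apply/andP/idP => [[]//|VP1]; by rewrite VP1 nx ?n1.
case: (boolP (V \in P1)) => [VP1|VP1] /=.
  by rewrite andbF (negbTE (d12 _ VP1)).
rewrite andbT; case: (boolP (V \in P2)) => VP2 /=; last by rewrite andbF orbF andbN.
by rewrite (nx _ (n2 _ VP2)) /= !andbT.
Qed.

Lemma next_unique N a b P : (a < b <= N)%N -> P \in NC_interval N a b ->
  forall x : 'I_N, x = a :> nat ->
  exists c0 : 'I_N.+1, forall c : 'I_N.+1,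
  ((a < c <= b)%N && next_in_block a b c x P) = (c == c0).
Proof.
move=> /andP[ab bN] PNC x xa.
pose Q c := ((a < c <= b)%N && ((c == b) || [exists i in block_at a P, i == c :> nat])).
have exQ : exists c, Q c by exists b; rewrite /Q eqxx ab leqnn.
case: (ex_minnP exQ) => m /andP[/andP[am mb] Qm] minm.
have mN : (m < N.+1)%N by lia.
have nm : next_in_block a b m x P.
  rewrite /next_in_block Qm andbT; apply/forall_inP => i iB.
  case: (eqVneq i x) => //= ix; apply: minm; rewrite /Q.
  have := block_at_sub PNC iB => /andP[ai ib]; rewrite (ltnW ib) andbT.
  apply/andP; split; first by rewrite ltn_neqAle ai andbT -xa eq_sym val_eqE.
  by apply/orP; right; apply/exists_inP; exists i.
exists (Ordinal mN) => c; apply/idP/eqP => [|->]; last by rewrite /= am mb.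
case/andP=> acb /andP[/forall_inP lec Qc]; apply/val_inj/eqP => /=.
rewrite eqn_leq minm ?andbT; last by rewrite /Q acb Qc.
case/orP: Qm => [/eqP->|/exists_inP[i iB /eqP im]]; first by case/andP: acb.
by have := lec _ iB; rewrite im => /orP[/eqP ix|//]; move: am; rewrite -im ix xa ltnn.
Qed.

(** In the recursion for blocks starting at [a], the gap before the next element
    is filled independently, and the shift remembers the removed element. The
    term [c = b] is the one where the first block ends; there the last factor
    is the empty sum [kappa j.+1]. *)
Lemma NC_sum_rec N j a b : (a < b <= N)%N ->
  NC_sum N j a b =
  \sum_(c < N.+1 | (a < c <= b)%N) NC_sum N 0 a.+1 c * NC_sum N j.+1 c b.
Proof.
move=> abN; have /andP[ab bN] := abN; have aN : (a < N)%N by lia.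
pose x := Ordinal aN; have xa : x = a :> nat by [].
transitivity (\sum_(P in NC_interval N a b)
   \sum_(c < N.+1 | (a < c <= b)%N && next_in_block a b c x P) weight j a P).
  apply: eq_bigr => P PNC; have [c0 Ec0] := next_unique abN PNC xa.
  by rewrite (big_pred1 c0).
rewrite (exchange_big_dep (fun c : 'I_N.+1 => (a < c <= b)%N)) /=; last first.
  by move=> P c _ /andP[].
apply: eq_bigr => c /andP[ac cb]; rewrite /NC_sum mulr_suml.
under [RHS]eq_bigr do rewrite mulr_sumr.
rewrite pair_big /=.
rewrite (reindex_onto (glue c x) (cut a c x)) /=; last first.
  by move=> P /andP[PNC /andP[_ nP]]; apply: (glue_cut xa ac cb bN).
apply: eq_big => [[P1 P2]|[P1 P2] /=].
  apply/idP/andP => /= [/andP[/andP[gNC /andP[_ ng]] /eqP gK]|[h1 h2]].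
    by have [] := cut_NC xa ac cb bN gNC ng; rewrite gK.
  have gNC := glue_NC xa ac cb bN h1 h2.
  by rewrite gNC ac cb (glue_next xa ac cb bN h1 h2) (cut_glue xa ac cb bN h1 h2) eqxx.
case/andP=> /andP[gNC /andP[_ ng]] /eqP gK.
have [] := cut_NC xa ac cb bN gNC ng; rewrite gK => h1 h2.
by apply: (weight_glue _ xa _ bN h1 h2); apply/andP.
Qed.

Lemma NC_sum_empty N j a : NC_sum N j a a = kappa j.
Proof.
rewrite /NC_sum (big_pred1 set0) => [|P].
  rewrite /weight /block_at !big_pred0 ?cards0 ?mulr1 // => V; by rewrite !inE.
apply/idP/eqP => [/NC_intervalP[inP _ _ ne _]|->].
  apply/setP => V; rewrite inE; apply/negP => VP; have [i iV] := ne V VP.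
  by have := inP _ _ VP iV; lia.
apply/NC_intervalP; split=> [V i|i|V W i|V|V W i j' k l]; rewrite ?inE //; lia.
Qed.

(** Only the length matters, since the recursion sees nothing else; this avoids
    transporting partitions along order isomorphisms. *)
Lemma NC_sum_shift N N' j a a' b b' : (a <= b <= N)%N -> (a' <= b' <= N')%N ->
  (b - a = b' - a')%N -> NC_sum N j a b = NC_sum N' j a' b'.
Proof.
have [m] := ubnP (b - a); elim: m => // m IH in N N' j a a' b b' *.
move=> bam /andP[ab bN] /andP[ab' bN'] e.
case: (ltngtP a b) ab => // [ab _|eab _]; last first.
  have <- : a' = b' by lia.
  by rewrite eab !NC_sum_empty.
rewrite !NC_sum_rec ?ab //; last by lia.
have natsum M (F : nat -> K) p q : (p <= q)%N -> (q <= M)%N ->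
    \sum_(c < M.+1 | (p < c <= q)%N) F c = \sum_(i < q - p) F (p.+1 + i)%N.
  move=> pq qM; rewrite -(big_mkord (fun c => (p < c <= q)%N)) -(big_mkord xpredT (fun i => F (p.+1 + i)%N)).
  have h1 : (p < M.+1)%N by lia.
  rewrite (big_cat_nat (n := p.+1)) //=.
  rewrite big_nat_cond big_pred0 ?add0r; last by move=> i; lia.
  rewrite (big_cat_nat (n := q.+1)) //=.
  rewrite [X in _ + X]big_nat_cond [X in _ + X]big_pred0 ?addr0; last by move=> i; lia.
  rewrite -{1}[p.+1]add0n big_addn subSS big_nat_cond [RHS]big_nat_cond.
  by apply: eq_big => [i|i _]; [lia | rewrite addnC].
rewrite !(natsum _ (fun c => NC_sum _ 0 _ c * NC_sum _ j.+1 c _)) //; try lia.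
by rewrite e; apply: eq_bigr => i _; congr (_ * _); apply: IH; have := ltn_ord i; lia.
Qed.

Definition NC_moment j n := NC_sum n j 0 n.

Lemma NC_moment0 j : NC_moment j 0 = kappa j.
Proof. exact: NC_sum_empty. Qed.

Lemma NC_momentS j n :
  NC_moment j n.+1 = \sum_(i < n.+1) NC_moment 0 i * NC_moment j.+1 (n - i).
Proof.
rewrite /NC_moment NC_sum_rec //= big_mkcond big_ord_recl /= add0r.
apply: eq_bigr => i _; rewrite /bump /= add1n (ltn_ord i); congr (_ * _).
  by apply: NC_sum_shift; have := ltn_ord i; lia.
by apply: NC_sum_shift; have := ltn_ord i; lia.
Qed.

End Weights.

(** * Truncated power series *)

Definition eqmodX (B : nzRingType) (k : nat) (f g : {poly B}) := forall i, (i < k)%N -> f`_i = g`_i.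

Notation "f = g %[modX k ]" := (eqmodX k f g)
  (at level 70, g at next level, format "f  =  g  %[modX  k ]") : ring_scope.

Section EqModX.
Variables (B : nzRingType).
Implicit Types (f g h z : {poly B}) (k : nat).

Lemma eqmodX_sym k f g : f = g %[modX k] -> g = f %[modX k].
Proof. by move=> fg i ik; rewrite fg. Qed.

Lemma eqmodX_trans k g f h : f = g %[modX k] -> g = h %[modX k] -> f = h %[modX k].
Proof. by move=> fg gh i ik; rewrite fg ?gh. Qed.

Lemma eqmodX_leq k l f g : (l <= k)%N -> f = g %[modX k] -> f = g %[modX l].
Proof. by move=> lk fg i il; apply: fg; apply: leq_trans lk. Qed.

Lemma eqmodXD k f f' g g' : f = f' %[modX k] -> g = g' %[modX k] -> f + g = f' + g' %[modX k].
Proof. by move=> ff gg i ik; rewrite !coefD ff ?gg. Qed.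

Lemma eqmodXB k f f' g g' : f = f' %[modX k] -> g = g' %[modX k] -> f - g = f' - g' %[modX k].
Proof. by move=> ff gg i ik; rewrite !coefB ff ?gg. Qed.

Lemma eqmodXM k f f' g g' : f = f' %[modX k] -> g = g' %[modX k] -> f * g = f' * g' %[modX k].
Proof.
move=> ff gg i ik; rewrite !coefM; apply: eq_bigr => j _.
by rewrite ff ?gg //; have := ltn_ord j; lia.
Qed.

Lemma eqmodXMl k f g g' : g = g' %[modX k] -> f * g = f * g' %[modX k].
Proof. exact: eqmodXM. Qed.

Lemma eqmodXMr k f f' g : f = f' %[modX k] -> f * g = f' * g %[modX k].
Proof. by move=> h; apply: eqmodXM. Qed.

Lemma eqmodX_exp k f f' n : f = f' %[modX k] -> f ^+ n = f' ^+ n %[modX k].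
Proof. by move=> ff; elim: n => // n IH; rewrite !exprS; apply: eqmodXM. Qed.

Lemma eqmodX_sum k I (r : seq I) (P : pred I) (F G : I -> {poly B}) :
  (forall i, P i -> F i = G i %[modX k]) ->
  \sum_(i <- r | P i) F i = \sum_(i <- r | P i) G i %[modX k].
Proof. by move=> FG j jk; rewrite !coef_sum; apply: eq_bigr => i /FG ->. Qed.

(** The gain of one order that makes every fixed-point argument below work. *)
Lemma eqmodXMS k z f g : z`_0 = 0 -> f = g %[modX k] -> z * f = z * g %[modX k.+1].
Proof.
move=> z0 fg i ik; rewrite !coefM; apply: eq_bigr => -[[|j] ji] _ /=.
  by rewrite z0 !mul0r.
by rewrite fg //; lia.
Qed.

Lemma eqmodX_exp0 k z : z`_0 = 0 -> z ^+ k = 0 %[modX k].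
Proof.
move=> z0; elim: k => // k IH; rewrite exprS -[X in _ = X %[modX _]](mulr0 z).
exact: eqmodXMS.
Qed.

(** The finite geometric sum stands for the inverse of 1 - z. *)
Lemma geometric_inverse k z : z`_0 = 0 -> (1 - z) * (\sum_(i < k) z ^+ i) = 1 %[modX k].
Proof.
move=> z0; have <- : 1 - z ^+ k = (1 - z) * (\sum_(i < k) z ^+ i).
  rewrite -{1}(expr1n _ k) (subrXX_comm _ (commr_sym (commr1 z))); congr (_ * _).
  by apply: eq_bigr => i _; rewrite expr1n mul1r.
rewrite -[X in _ = X %[modX _]]subr0; apply: eqmodXB => //; exact: eqmodX_exp0.
Qed.

End EqModX.

Section Field.
Variable (K : fieldType).
Implicit Types (f g h u z : {poly K}).

Lemma eqmodX_cancel k u f g : u`_0 != 0 -> u * f = u * g %[modX k] -> f = g %[modX k].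
Proof.
move=> u0 e i; have [m] := ubnP i; elim: m i => // m IH i im ik.
have := e i ik; rewrite !coefM !big_ord_recl /= subn0.
rewrite (eq_bigr (fun j : 'I_i => u`_(bump 0 j) * g`_(i - bump 0 j))); last first.
  by move=> j _; rewrite (IH (i - bump 0 j)%N) //; have := ltn_ord j; rewrite /bump /=; lia.
by move/addIr/(mulfI u0).
Qed.

Lemma eqmodX_inverse k u : u`_0 != 0 -> exists v, u * v = 1 %[modX k].
Proof.
move=> u0; pose e := 1 - (u`_0)^-1 *: u.
have e0 : e`_0 = 0 by rewrite coefB coef1 coefZ mulVf ?subrr.
exists ((u`_0)^-1 *: \sum_(i < k) e ^+ i).
by have := @geometric_inverse _ k _ e0; rewrite {1}/e subKr -scalerAl scalerAr.
Qed.

Lemma eqmodX_comp k f g z : z`_0 = 0 -> f = g %[modX k] -> f \Po z = g \Po z %[modX k].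
Proof.
move=> z0 fg; have -> : f = g + drop_poly k (f - g) * 'X^k.
  rewrite -[f in LHS](subrK g) addrC; congr (_ + _).
  rewrite -[LHS](poly_take_drop k); rewrite [take_poly _ _](_ : _ = 0) ?add0r //.
  apply/polyP => i; rewrite coef_take_poly coef0; case: ltnP => // ik.
  by rewrite coefB fg ?subrr.
rewrite comp_polyD comp_polyM comp_Xn_poly -[X in _ = X %[modX _]]addr0.
apply: eqmodXD => //; rewrite -[X in _ = X %[modX _]](mulr0 (drop_poly k (f - g) \Po z)).
by apply: eqmodXMl; apply: eqmodX_exp0.
Qed.

(** Since [z] has no constant term, agreement of [f] and [g] to order [l] implies
    agreement of the right-hand sides to order [l + 1]. *)
Lemma fixpoint_unique k (c : nat -> K) f g z : z`_0 = 0 ->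
  f = \sum_(s < k) c s *: (z * f) ^+ s %[modX k] ->
  g = \sum_(s < k) c s *: (z * g) ^+ s %[modX k] ->
  f = g %[modX k].
Proof.
move=> z0 ef eg.
suff h l : (l <= k)%N -> f = g %[modX l] by apply: h.
elim: l => [|l IH] lk; first by move=> i.
apply: eqmodX_trans (eqmodX_leq lk ef) _; apply: eqmodX_trans (eqmodX_sym (eqmodX_leq lk eg)).
apply: eqmodX_sum => s _; rewrite -!mul_polyC; apply: eqmodXMl; apply: eqmodX_exp.
by apply: eqmodXMS => //; apply: IH; apply: ltnW.
Qed.

End Field.

Section MomentSeries.
Variables (K : fieldType) (kappa : nat -> K).
Hypothesis kappa0 : kappa 0 = 1.

Let F k j : {poly K} := \poly_(i < k) NC_moment kappa j i.

Let F_rec k j : F k j = (kappa j)%:P + 'X * F k 0 * F k j.+1 %[modX k].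
Proof.
move=> [|i] ik; rewrite coef_poly ik coefD coefC /= -mulrA coefXM /=.
  by rewrite addr0 NC_moment0.
rewrite add0r NC_momentS // coefM; apply: eq_bigr => j' _.
by rewrite !coef_poly !ifT //; have := ltn_ord j'; lia.
Qed.

(** Unfolding F_j = kappa_j + X F_0 F_(j+1), the series form of [NC_momentS],
    starting from F_0. *)
Lemma moment_series k : let F := \poly_(i < k) NC_moment kappa 0 i in
  F = \sum_(s < k) kappa s *: ('X * F) ^+ s %[modX k].
Proof.
rewrite /= -/(F k 0); set y := 'X * F k 0.
have y0 : y`_0 = 0 by rewrite coefXM.
have h n : F k 0 = \sum_(s < n) kappa s *: y ^+ s + y ^+ n * F k n %[modX k].
  elim: n => [|n IH]; first by rewrite big_ord0 add0r expr0 mul1r.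
  apply: eqmodX_trans IH _; rewrite big_ord_recr /= -addrA; apply: eqmodXD => //.
  rewrite exprSr -mulrA -mul_polyC [_%:P * _]mulrC -mulrDr; apply: eqmodXMl.
  exact: F_rec.
apply: eqmodX_trans (h k) _; rewrite -[X in _ = X %[modX _]]addr0; apply: eqmodXD => //.
by rewrite -[X in _ = X %[modX _]](mul0r (F k k)); apply: eqmodXMr; apply: eqmodX_exp0.
Qed.

End MomentSeries.

(** * The relation between moments and compressed moments *)

Section Subordination.
Variables (K : fieldType) (alpha : K).

(** The equation sum_j t_j (y/u)^j = u to order k, with y = X M and
    u = alpha - 1 + M, multiplied by u^(k-1) to clear the denominators. *)
Definition subordination_relation (m t : nat -> K) k :=
  let M := \poly_(i < k) m i in let u := (alpha - 1)%:P + M in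
  \sum_(j < k) t j *: (('X * M) ^+ j * u ^+ (k.-1 - j)) = u ^+ k %[modX k].

Lemma eq_subordination_relation (m m' t : nat -> K) k : m =1 m' ->
  subordination_relation m t k -> subordination_relation m' t k.
Proof. by move=> mm'; rewrite /subordination_relation (eq_poly _ (fun i _ => mm' i)). Qed.

(** At order j + 1 the relation involves t_0, ..., t_j only, and t_j enters
    through the coefficient of X^j in t_j X^j M^j, which is t_j. *)
Lemma subordination_relation_unique (m t t' : nat -> K) : m 0 = 1 ->
  (forall k, (0 < k)%N -> subordination_relation m t k) ->
  (forall k, (0 < k)%N -> subordination_relation m t' k) -> t =1 t'.
Proof.
move=> m0 ht ht' j; have [l] := ubnP j; elim: l j => // l IH j jl.
have := ht j.+1 isT; have := ht' j.+1 isT; rewrite /subordination_relation.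
set M := \poly_(_ < _) _; set u := _ + M; move=> /eqmodX_sym h' h.
have := eqmodX_trans h h' (ltnSn j); rewrite !big_ord_recr /=.
rewrite (eq_bigr (fun i : 'I_j => t' i *: (('X * M) ^+ i * u ^+ (j - i)))); last first.
  by move=> i _; rewrite IH //; have := ltn_ord i; lia.
rewrite !coefD => /addrI; rewrite subnn expr0 mulr1 !coefZ exprMn.
have -> : ('X^j * M ^+ j)`_j = 1.
  by rewrite coefXnM ltnn subnn -horner_coef0 horner_exp horner_coef0 coef_poly m0 expr1n.
by rewrite !(mulrC _ 1) !mul1r.
Qed.

End Subordination.

Section Compression.
Variables (K : fieldType) (alpha : K) (kappa kappa' : nat -> K).
Hypotheses (alpha0 : alpha != 0) (kappa0 : kappa 0 = 1) (kappa'0 : kappa' 0 = 1).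
Hypothesis kappa'E : forall s, (0 < s)%N -> kappa' s = alpha ^+ s.-1 * kappa s.

Let m := NC_moment kappa 0.
Let H := NC_moment kappa' 0.

(** With z = y/u, the series u / alpha and H(z) both solve
    f = sum_s kappa'_s (z f)^s: the first by [moment_series] for [kappa], as
    z u / alpha = y / alpha, and the second by [moment_series] for [kappa']
    composed with z. *)
Lemma compression_series_relation k : (0 < k)%N ->
  subordination_relation alpha m (fun j => alpha * H j) k.
Proof.
move=> k0; rewrite /subordination_relation; set M := \poly_(i < k) m i; set u := _ + M.
set y := 'X * M.
have m0 : m 0%N = 1 by rewrite /m NC_moment0.
have u0 : u`_0 = alpha by rewrite coefD coefC /= coef_poly k0 m0 subrK.
have y0 : y`_0 = 0 by rewrite coefXM.
have [v uv] := @eqmodX_inverse _ k u ltac:(by rewrite u0).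
pose z := y * v.
have z0 : z`_0 = 0 by rewrite /z coefM big_ord1 y0 mul0r.
have uz : u * z = y %[modX k].
  rewrite /z mulrCA -[X in _ = X %[modX _]]mulr1; exact: eqmodXMl.
pose HP := \poly_(i < k) H i.
have eW : HP \Po z = \sum_(s < k) kappa' s *: (z * (HP \Po z)) ^+ s %[modX k].
  have := eqmodX_comp z0 (@moment_series _ _ kappa'0 k); rewrite -/HP => e.
  apply: eqmodX_trans e _; rewrite /= raddf_sum; apply: eqmodX_sum => s _ /=.
  by rewrite linearZ /= rmorphXn /= rmorphM /= comp_polyX.
have eu : alpha^-1 *: u = \sum_(s < k) kappa' s *: (z * (alpha^-1 *: u)) ^+ s %[modX k].
  apply: (@eqmodX_trans _ _ (\sum_(s < k) kappa' s *: (alpha^-1 *: y) ^+ s)); last first.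
    apply: eqmodX_sum => s _; rewrite -!mul_polyC; apply: eqmodXMl; apply: eqmodX_exp.
    rewrite [z * _]mulrCA; apply: eqmodXMl; rewrite mulrC; exact: eqmodX_sym.
  have := @moment_series _ _ kappa0 k; rewrite /= -/m -/M -/y => eM.
  have {}eM : u = (alpha - 1)%:P + \sum_(s < k) kappa s *: y ^+ s %[modX k] by apply: eqmodXD.
  rewrite -mul_polyC; apply: eqmodX_trans (eqmodXMl _ eM) _.
  rewrite (bigD1 (Ordinal k0)) //= [X in _ = X %[modX _]](bigD1 (Ordinal k0)) //=.
  rewrite !expr0 kappa0 kappa'0 !scale1r addrA -polyC1 -polyCD subrK mulrDr -polyCM mulVf //.
  apply: eqmodXD => //; rewrite mulr_sumr; apply: eqmodX_sum => s s0.
  have {}s0 : (0 < s)%N by move: s0; rewrite -val_eqE /= lt0n.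
  rewrite mul_polyC scalerA kappa'E // exprZn scalerA.
  suff -> : alpha ^+ s.-1 * kappa s * alpha^-1 ^+ s = alpha^-1 * kappa s by [].
  rewrite mulrAC exprVn -{2}(prednK s0) exprS invfM mulrCA.
  by rewrite mulfV ?expf_neq0 // mulr1.
have := fixpoint_unique z0 eW eu => eHu.
have {eHu} : \sum_(j < k) (alpha * H j) *: z ^+ j = u %[modX k].
  apply: (@eqmodX_trans _ _ (alpha%:P * (HP \Po z))).
    rewrite comp_polyE mulr_sumr (big_ord_widen k (fun j => alpha%:P * (HP`_j *: z ^+ j))) ?size_poly //.
    rewrite [X in _ = X %[modX _]]big_mkcond /=; apply: eqmodX_sum => j _.
    case: ltnP => [_|/(nth_default 0) hj].
      by rewrite coef_poly ltn_ord mul_polyC scalerA.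
    by move: hj; rewrite coef_poly ltn_ord => ->; rewrite mulr0 scale0r.
  apply: eqmodX_trans (eqmodXMl _ eHu) _.
  by rewrite mul_polyC scalerA mulfV // scale1r.
move=> eHu; rewrite -(ltn_predK k0) exprSr [u in X in _ = X %[modX _]]lock.
rewrite (ltn_predK k0) -lock; apply: eqmodX_trans (eqmodXMl _ eHu); rewrite mulr_sumr.
apply: eqmodX_sum => j _; rewrite -scalerAr -!mul_polyC; apply: eqmodXMl.
have jk : (j <= k.-1)%N by have := ltn_ord j; lia.
rewrite -{2}(subnK jk) exprD [_ ^+ j * _]mulrC -mulrA; apply: eqmodXMl.
by rewrite -exprMn; apply: eqmodX_exp; apply: eqmodX_sym.
Qed.

End Compression.

(** * Compression by a free idempotent *)

Section FreeCompression.
Variables (K : fieldType) (B : nzRingType).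
Variables (iota : {rmorphism K -> B}) (phi : {additive B -> K}).
Hypothesis iota_central : forall c x, iota c * x = x * iota c.
Hypothesis phi_iota : forall c x, phi (iota c * x) = c * phi x.
Hypothesis phi1 : phi 1 = 1.

Local Notation J := (map_poly iota).
Local Notation Phi := (map_poly phi).

Lemma map_iota_central f (g : {poly B}) : J f * g = g * J f.
Proof.
apply/polyP => i; rewrite coefM coefMr; apply: eq_bigr => j _.
by rewrite coef_map iota_central.
Qed.

Lemma map_phi_scale f (g : {poly B}) : Phi (J f * g) = f * Phi g.
Proof.
apply/polyP => i; rewrite coef_map /= !coefM raddf_sum; apply: eq_bigr => j _.
by rewrite !coef_map /= phi_iota.
Qed.

Lemma map_phi_eqmodX k (f g : {poly B}) : f = g %[modX k] -> Phi f = Phi g %[modX k].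
Proof. by move=> fg i ik; rewrite !coef_map /= fg. Qed.

Variables (S : bool -> B -> Prop) (free : freely_independent phi S).

Fixpoint alternating (e : bool) (w : bool -> {poly B}) n : {poly B} :=
  if n is n'.+1 then w e * alternating (~~ e) w n' else 1.

(** Each coefficient of an alternating product of series is a sum of alternating
    products of coefficients, to which freeness applies. *)
Lemma alternating_vanish (w : bool -> {poly B}) :
  (forall e i, S e (w e)`_i /\ phi (w e)`_i = 0) ->
  forall e n, Phi (alternating e w n.+1) = 0.
Proof.
move=> hw.
(* [s] collects the coefficients already extracted from the leading factors *)
have H n : forall e (s : seq (bool * B)) i, sorted (fun u v => u.1 != v.1) s ->
    (forall u, u \in s -> S u.1 u.2 /\ phi u.2 = 0) ->
    last (~~ e) (map fst s) = ~~ e -> (0 < size s + n)%N ->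
    phi ((\prod_(u <- s) u.2) * (alternating e w n)`_i) = 0.
  elim: n => [|n IH] e s i s_alt s_free s_last.
    rewrite addn0 lt0n size_eq0 /= coef1 => s0.
    by case: eqP => _; rewrite ?mulr0 ?raddf0 ?mulr1 ?free.
  move=> _ /=; rewrite coefM mulr_sumr raddf_sum big1 // => j _ /=; rewrite mulrA.
  have -> : (\prod_(u <- s) u.2) * (w e)`_j = \prod_(u <- rcons s (e, (w e)`_j)) u.2.
    by rewrite big_rcons.
  apply: IH.
  - case: s s_alt s_last {s_free} => //= u s s_alt; rewrite rcons_path s_alt last_map => -> /=.
    by case: (e).
  - by move=> u; rewrite mem_rcons inE => /orP[/eqP-> /=|/s_free].
  - by rewrite map_rcons last_rcons /= negbK.
  - by rewrite size_rcons.
move=> e n; apply/polyP => i; rewrite coef_map coef0.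
by have := H n.+1 e [::] i isT; rewrite big_nil mul1r; apply.
Qed.

Lemma alternating_double e w i n :
  alternating e w (i.*2 + n) = (w e * w (~~ e)) ^+ i * alternating e w n.
Proof. by elim: i => [|i IH]; rewrite ?mul1r // doubleS /= negbK IH exprS !mulrA. Qed.

Variables (x p : B).
Hypothesis p_idem : p * p = p.
Hypothesis S_moment : forall i, S true (x ^+ i - iota (phi (x ^+ i))).
Hypotheses (S_p : S false (p - iota (phi p))) (S_0 : S false 0).
Hypothesis phi_p0 : phi p != 0.

(** With D = alpha M, [T] plays the role of D^k (D - a b)^-1 and [G] that of u^k p Q^-1, where
    Q = (1 - w x)(D - a b). Computing G Q T R in two ways compares [G], whose
    image under [phi] is the left-hand side, with p T R, whose image is D^k by
    freeness. *)
Lemma compression_moment_relation k : (0 < k)%N ->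
  subordination_relation (phi p) (fun n => phi (x ^+ n)) (fun j => phi ((p * x) ^+ j * p)) k.
Proof.
move=> k0; rewrite /subordination_relation; set alpha := phi p.
set M := \poly_(i < k) phi (x ^+ i); set u := _ + M.
pose R := \poly_(i < k) x ^+ i; pose a := R - J M; pose b := (p - iota alpha)%:P.
pose D := alpha%:P * M; pose y := 'X * M.
pose P j : B := (p * x) ^+ j * p.
pose G := \sum_(j < k) J (y ^+ j * u ^+ (k.-1 - j)) * (P j)%:P.
pose T := \sum_(i < k) J D ^+ (k.-1 - i) * (a * b) ^+ i.
pose X1 := 1 - x%:P * 'X : {poly B}.
pose Q := (J alpha%:P - p%:P) + X1 * (J M * p%:P).
have XRE : X1 * R = 1 %[modX k].
  case=> [|i] ik; rewrite /X1 mulrBl mul1r coefB -mulrA coefCM coefXM coef1 !coef_poly ?ik /=.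
    by rewrite mulr0 subr0.
  by rewrite (ltnW ik) exprS subrr.
have resolvent : X1 * (J D - a * b) = Q %[modX k].
  have -> : J D - a * b = R * (J alpha%:P - p%:P) + J M * p%:P.
    rewrite /a /b polyCB -(map_polyC iota) /D rmorphM /= mulrBl !mulrBr !opprB.
    rewrite (map_iota_central _ (J M)) addrCA addrA subrK addrC.
    by [].
  rewrite mulrDr; apply: eqmodXD => //.
  by rewrite mulrA -[X in _ = X %[modX _]]mul1r; apply: eqmodXMr.
have ab0 : (a * b) ^+ k = 0 %[modX k].
  apply: eqmodX_exp0; rewrite coefM big_ord1 coefB coef_map !coef_poly k0 /= phi1 rmorph1 subrr.
  by rewrite mul0r.
have DT : (J D - a * b) * T = J D ^+ k - (a * b) ^+ k.
  by rewrite /T (subrXX_comm _ (map_iota_central _ _)).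
have GQ : G * Q = J (u ^+ k) * p%:P - J (y ^+ k) * (P k)%:P.
  have PQ j : (P j)%:P * Q = J u * (P j)%:P - J y * (P j.+1)%:P.
    have Pp : (P j)%:P * p%:P = (P j)%:P by rewrite -polyCM /P -mulrA p_idem.
    have Pxp : (P j)%:P * x%:P * p%:P = (P j.+1)%:P.
      by rewrite -!polyCM /P exprSr !mulrA.
    rewrite /Q /X1 mulrDr mulrBr Pp -map_iota_central mulrA [_ * (1 - _)]mulrBr mulr1 mulrBl.
    rewrite [in X in _ + (X - _)]mulrA -map_iota_central -[in X in _ + (X - _)]mulrA Pp.
    have -> : (P j)%:P * (x%:P * 'X) * (J M * p%:P) = J y * (P j.+1)%:P.
      have Jy : J y = 'X * J M by rewrite /y [J _]rmorphM /= map_polyX.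
      by rewrite -Pxp [RHS]mulrA (map_iota_central y) Jy !mulrA.
    rewrite /u rmorphD polyCB rmorphB /= polyC1 rmorph1 mulrDl mulrBl mul1r addrA.
    by [].
  (* the relation [PQ] makes the sum telescope *)
  pose f j := J (y ^+ j * u ^+ (k - j)) * (P j)%:P.
  transitivity (- (\sum_(0 <= j < k) (f j.+1 - f j))).
    rewrite big_mkord -sumrN /G mulr_suml; apply: eq_bigr => j _.
    rewrite opprB -mulrA PQ mulrBr !mulrA -!rmorphM /f; congr (J _ * _ - J _ * _).
      by rewrite -mulrA -exprSr; congr (_ * _ ^+ _); have := ltn_ord j; lia.
    rewrite mulrAC -exprSr; congr (_ * _ ^+ _); have := ltn_ord j; lia.
  by rewrite telescope_sumr // opprB /f expr0 mul1r subn0 subnn expr0 mulr1 /P expr0 mul1r.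
have main : J (D ^+ k) * G = J (u ^+ k) * (p%:P * T * R) %[modX k].
  have e1 : J (D ^+ k) * G = G * (X1 * (J D - a * b)) * T * R %[modX k].
    rewrite -[_ * _ * T]mulrA -[X1 * _ * T]mulrA DT map_iota_central -rmorphXn -!mulrA.
    apply: eqmodXMl; rewrite [_ * R]mulrBl (mulrBr X1) /=; apply: eqmodX_sym.
    rewrite -[X in _ = X %[modX _]]subr0; apply: eqmodXB.
      by rewrite mulrA -map_iota_central -mulrA -[X in _ = X %[modX _]]mulr1; apply: eqmodXMl.
    rewrite -[X in _ = X %[modX _]](mulr0 X1); apply: eqmodXMl.
    by rewrite -[X in _ = X %[modX _]](mul0r R); apply: eqmodXMr.
  apply: eqmodX_trans e1 _; rewrite -!mulrA (mulrA X1).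
  apply: eqmodX_trans (eqmodXMl _ (eqmodXMr _ resolvent)) _.
  rewrite mulrA GQ mulrBl -[X in _ = X %[modX _]]subr0 !mulrA; apply: eqmodXB => //.
  have y0 : y`_0 = 0 by rewrite coefXM.
  apply: eqmodX_trans (_ : J (y ^+ k) * ((P k)%:P * T * R) = 0 %[modX k]); first by rewrite !mulrA.
  rewrite -[X in _ = X %[modX _]](mul0r ((P k)%:P * T * R)); apply: eqmodXMr.
  by move=> i ik; rewrite coef_map /= (eqmodX_exp0 y0 ik) !coef0 rmorph0.
have PhiT : Phi (p%:P * T * R) = D ^+ k.
  pose w e := if e then a else b.
  have hw e i : S e (w e)`_i /\ phi (w e)`_i = 0.
    have phi_centered z : phi (z - iota (phi z)) = 0.
      by rewrite raddfB /= -[iota _]mulr1 phi_iota phi1 mulr1 subrr.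
    case: e; rewrite /= ?coefB ?coef_map ?coef_poly ?coefC /=.
      case: ifP => _; first by split; [exact: S_moment | exact: phi_centered].
      by have := S_moment 0; rewrite expr0 phi1 rmorph1 rmorph0 !subrr raddf0.
    by case: ifP => _; [split; [exact: S_p|exact: phi_centered] | rewrite raddf0].
  have vanish := alternating_vanish hw.
  have ER : R = a + J M by rewrite /a subrK.
  have Ep : p%:P = b + J alpha%:P by rewrite /b polyCB map_polyC subrK.
  (* only the constant parts of p = b + alpha and R = a + M around the empty
     word contribute *)
  have word i : Phi (p%:P * (a * b) ^+ i * R) = if i == 0%N then D else 0.
    have odd_word : (a * b) ^+ i * a = alternating true w i.*2.+1.
      by rewrite -addn1 alternating_double /= mulr1.
    have even_word : (a * b) ^+ i = alternating true w i.*2.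
      by rewrite -[i.*2]addn0 alternating_double mulr1.
    have word_a : Phi ((a * b) ^+ i * a) = 0 by rewrite odd_word vanish.
    have word_b : Phi (b * (a * b) ^+ i) = 0.
      by rewrite even_word; apply: (vanish false i.*2).
    have word_ba : Phi (b * (a * b) ^+ i * a) = 0.
      by rewrite -mulrA odd_word; apply: (vanish false i.*2.+1).
    have word_ab : Phi ((a * b) ^+ i) = (i == 0%N)%:R.
      case: i even_word {odd_word word_a word_b word_ba} => [|i] even_word.
        by rewrite expr0 -polyC1 map_polyC /= phi1.
      by rewrite even_word vanish.
    rewrite ER Ep; set E := (a * b) ^+ i.
    have -> : (b + J alpha%:P) * E * (a + J M) =
        b * E * a + J alpha%:P * (E * a) + (J M * (b * E) + J M * (J alpha%:P * E)).
      by rewrite mulrDr -(map_iota_central M) !mulrDl mulrDr !mulrA.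
    rewrite !raddfD /= !map_phi_scale word_a word_b word_ba word_ab !mulr0 !add0r.
    by case: eqP; rewrite ?mulr0 // mulr1 mulrC.
  rewrite /T mulr_sumr mulr_suml raddf_sum /= (bigD1 (Ordinal k0)) //= big1 => [|i i0].
    rewrite addr0 subn0 -rmorphXn mulrA -map_iota_central -!mulrA map_phi_scale mulrA word /=.
    by rewrite -exprSr prednK.
  rewrite -rmorphXn mulrA -map_iota_central -!mulrA map_phi_scale mulrA word.
  by move: i0; rewrite -val_eqE /= => /negbTE->; rewrite mulr0.
have := map_phi_eqmodX main; rewrite !map_phi_scale PhiT [u ^+ k * _]mulrC.
have D0 : (D ^+ k)`_0 != 0.
  rewrite -horner_coef0 horner_exp expf_neq0 // hornerM hornerC horner_coef0 coef_poly k0.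
  by rewrite phi1 mulr1.
move/(eqmodX_cancel D0); rewrite /G raddf_sum /=.
congr (eqmodX _ _ _); apply: eq_bigr => j _.
by rewrite map_phi_scale map_polyC mulrC mul_polyC.
Qed.

End FreeCompression.

(** * Cumulants and noncrossing sums *)

Section Cumulants.
Variable R : realType.
Implicit Types (mu : distribution R) (kappa : nat -> R[i]).

(** The value at 0 is what the empty first block contributes to the sums. *)
Definition unital kappa (n : nat) : R[i] := if n is 0 then 1 else kappa n.

Lemma NC_moment_unital kappa n : NC_moment (unital kappa) 0 n = moments_of_cumulants kappa n.
Proof.
rewrite /NC_moment /NC_sum /moments_of_cumulants.
have full : ord_interval n 0 n = [set: 'I_n] by apply/setP => i; rewrite !inE ltn_ord.
apply: eq_big => [P|P PNC]; first by rewrite !inE full.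
rewrite (weight0E _ _ PNC) ?leqnn //; apply: eq_bigr => V VP.
have /NC_intervalP[_ _ _ ne _] := PNC.
have [i iV] := ne V VP.
by have : (0 < #|V|)%N by [apply/card_gt0P; exists i]; rewrite /unital; case: #|V|.
Qed.

(** The block sizes of a partition of n elements add up to n, so every term of
    the moment-cumulant formula scales by c^n. *)
Lemma free_cumulant_dilation c mu n : (0 < n)%N ->
  free_cumulant (dilation c mu) n = c ^+ n * free_cumulant mu n.
Proof.
elim/ltn_ind: n => -[|n] // IH _; rewrite /free_cumulant /= mulrBr; congr (_ - _).
rewrite mulr_sumr; apply: eq_bigr => P /andP[PNC P1].
have -> : c ^+ n.+1 = \prod_(V in P) c ^+ #|V|.
  rewrite prodrXr -(card_partition (D := [set: 'I_n.+1])) ?cardsT ?card_ord //.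
  by move: PNC; rewrite inE => /andP[].
rewrite -big_split /=; apply: eq_bigr => V VP.
have /andP[V0 Vn] := NC_block_lt PNC P1 VP.
by rewrite !free_cumulant_recE ?IH.
Qed.

End Cumulants.

(** * Diagonal entries of a matrix free from the scalar matrices *)

Section MatrixCompression.
Variables (R : realType) (A : algType R[i]) (tau : {scalar A}) (n : nat).
Hypothesis tau1 : tau 1 = 1.

Local Notation phi := (@mx_state R A tau n.+1).

Fact mx_state_is_additive : zmod_morphism phi.
Proof.
move=> M N; rewrite /mx_state -mulrBr -sumrB; congr (_ * _).
by apply: eq_bigr => i _; rewrite !mxE raddfB.
Qed.

HB.instance Definition _ := GRing.isZmodMorphism.Build _ _ phi mx_state_is_additive.

Let iota : {rmorphism R[i] -> 'M[A]_n.+1} := scalar_mx \o in_alg A.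

Let phi1 : phi 1 = 1.
Proof.
rewrite /mx_state (eq_bigr (fun=> 1)) => [|i _]; last by rewrite mxE eqxx.
by rewrite sumr_const card_ord mulVf // pnatr_eq0.
Qed.

Let phi_iota c M : phi (iota c * M) = c * phi M.
Proof.
rewrite /mx_state mulrCA [c * _]mulr_sumr; congr (_ * _); apply: eq_bigr => i _.
by rewrite /= -mulmxE mul_scalar_mx mxE mulr_algl linearZ.
Qed.

Let iota_central c M : iota c * M = M * iota c.
Proof.
apply/matrixP => i j; rewrite /= -!mulmxE mul_scalar_mx !mxE (bigD1 j) //=.
rewrite big1 ?addr0 => [|l lj]; first by rewrite mxE eqxx mulr_algl mulr_algr.
by rewrite mxE (negbTE lj) mulr0.
Qed.

Lemma delta_mx_word (X : 'M[A]_n.+1) i j :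
  (delta_mx i i * X) ^+ j * delta_mx i i = X i i ^+ j *: delta_mx i i.
Proof.
have corner : delta_mx i i * X * delta_mx i i = X i i *: delta_mx i i.
  apply/matrixP => a b; rewrite -!mulmxE !mxE (bigD1 i) //= big1 ?addr0 => [|l li]; last first.
    by rewrite [delta_mx _ _ l b]mxE (negbTE li) mulr0.
  rewrite !mxE (bigD1 i) //= big1 ?addr0 => [|l li]; last first.
    by rewrite !mxE (negbTE li) andbF mul0r.
  rewrite !mxE !eqxx /= andbT; case: eqP => _; case: eqP => _ /=; by rewrite ?(mulr0, mul0r, mulr1, mul1r).
elim: j => [|j IH]; first by rewrite !expr0 mul1r scale1r.
by rewrite exprSr mulrA IH -!scalerAl corner scalerA exprSr.
Qed.

Lemma generated_algebra_exp (X : 'M[A]_n.+1) j : generated_algebra X (X ^+ j).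
Proof.
elim: j => [|j IH]; last by rewrite exprS; apply: generated_mul => //; apply: generated_self.
by have := generated_scalar X 1; rewrite scale1r.
Qed.

(** The entry X_ii, as an element of [A], is the compression of X by the
    projection E_ii, of trace 1/N. *)
Lemma diagonal_entry_moments (X : 'M[A]_n.+1) (mu : distribution R) i j :
  free_from_complex_matrices tau X -> distr phi X =1 mu ->
  tau (X i i ^+ j) = free_power (dilation n.+1%:R^-1 mu) n.+1%:R j.
Proof.
move=> X_free X_mu.
set N : R[i] := n.+1%:R.
have N0 : N != 0 by rewrite pnatr_eq0.
pose p : 'M[A]_n.+1 := delta_mx i i.
have phi_p (a : A) : phi (a *: p) = N^-1 * tau a.
  rewrite /mx_state (bigD1 i) //= big1 ?addr0 => [|l li]; last first.
    by rewrite !mxE (negbTE li) mulr0 raddf0.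
  by rewrite !mxE !eqxx mulr1.
have phi_p1 : phi p = N^-1 by rewrite -[p]scale1r phi_p tau1 mulr1.
have p_idem : p * p = p by rewrite -mulmxE mul_delta_mx.
have iota_gen c : generated_algebra X (iota c) by apply: generated_scalar.
have gen_moment s : generated_algebra X (X ^+ s - iota (phi (X ^+ s))).
  rewrite -[- _](rmorphN iota); apply: generated_add; last exact: iota_gen.
  exact: generated_algebra_exp.
have complex_p : complex_matrix (p - iota (phi p)).
  exists (delta_mx i i - (phi p)%:M).
  by rewrite raddfB /= map_delta_mx map_scalar_mx.
have complex_0 : complex_matrix (0 : 'M[A]_n.+1) by exists 0; rewrite raddf0.
have phi_p0 : phi p != 0 by rewrite phi_p1 invr_eq0.
have rel k (k0 : (0 < k)%N) := compression_moment_relation iota_central phi_iota phi1 X_free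
  p_idem gen_moment complex_p complex_0 phi_p0 k0.
pose kappa := unital (free_cumulant mu).
pose kappa' := unital (fun s => N * free_cumulant (dilation N^-1 mu) s).
have momentsE s : NC_moment kappa 0 s = phi (X ^+ s).
  rewrite [RHS](X_mu s) NC_moment_unital.
  case: s => [|s]; last by rewrite moments_of_cumulantsK.
  by rewrite -NC_moment_unital NC_moment0 -(X_mu 0%N) /distr expr0 phi1.
have kappa'E s : (0 < s)%N -> kappa' s = phi p ^+ s.-1 * kappa s.
  case: s => // s _; rewrite /kappa' /kappa /= free_cumulant_dilation // phi_p1 exprS !mulrA.
  by rewrite mulfV // mul1r.
have rel' k (k0 : (0 < k)%N) := compression_series_relation phi_p0 (erefl : kappa 0%N = 1)
  (erefl : kappa' 0%N = 1) kappa'E k0.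
have := subordination_relation_unique (m := fun s => phi (X ^+ s)) _ rel
  (fun k k0 => eq_subordination_relation momentsE (rel' k k0)).
rewrite expr0 phi1 => /(_ erefl j) /=; rewrite delta_mx_word phi_p phi_p1.
by rewrite NC_moment_unital => /mulfI; apply; rewrite invr_eq0.
Qed.


End MatrixCompression.

Theorem proposition4p10 (R : realType) (A : algType R[i]) (star : A -> A)
    (tau : {scalar A}) (gT : finGroupType) (en : 'I_#|gT| -> gT)
    (X : 'M[A]_#|gT|) (mu : distribution R) (Y : gT -> 'M[A]_#|gT|) :
  is_tracial_star_probability_space star tau ->
  bijective en ->
  mx_adjoint star X = X ->
  free_from_complex_matrices tau X ->
  distr (@mx_state R A tau #|gT|) X =1 mu ->
  (forall g : gT, Y g = left_circulant en X^T g) ->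
  distr (@mx_state R A tau #|gT|) (Y 1%g)
    =1 free_power (dilation (#|gT|%:R^-1) mu) #|gT|%:R.
Proof.
move=> [_ tau1 _] en_bij _ X_free X_mu YE.
have gT_gt0 : (0 < #|gT|)%N by apply/card_gt0P; exists 1%g.
have {YE} -> : Y 1%g = \matrix_(i, j) if i == j then X i i else 0.
  rewrite YE; apply/matrixP => i j; rewrite !mxE mul1g (bij_eq en_bij) eq_sym.
  by case: eqP => // ->.
clear en en_bij Y; move: #|gT| gT_gt0 X X_free X_mu => [//|n] _ X X_free X_mu j.
have diag_exp : (\matrix_(i, j) if i == j then X i i else 0) ^+ j =
    \matrix_(i, l) (if i == l then X i i ^+ j else 0) :> 'M[A]_n.+1.
  elim: j => [|j IH].
    by apply/matrixP => i l; rewrite expr0 !mxE; case: eqP.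
  rewrite exprS IH; apply/matrixP => i l; rewrite -mulmxE !mxE (bigD1 i) //= big1 ?addr0 => [|h hi].
    by rewrite !mxE eqxx; case: eqP; rewrite ?mulr0 // exprS.
  by rewrite !mxE eq_sym (negbTE hi) mul0r.
rewrite /distr diag_exp /mx_state.
rewrite (eq_bigr (fun=> free_power (dilation n.+1%:R^-1 mu) n.+1%:R j)) => [|i _].
  by rewrite sumr_const card_ord -[X in _ * X]mulr_natl mulKf // pnatr_eq0.
by rewrite mxE eqxx (diagonal_entry_moments tau1 i j X_free X_mu).
Qed.
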